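(* Let $n\ge 3$ and $r\ge 2$ be integers, and let $M:=R_{1/r}(n-1,n,\ldots,n)$ (with $r+1$ arguments, one equal to $n-1$ and $r$ equal to $n$). If $G$ is a graph with $G\stackrel{1/(r+1)}{\longrightarrow}K_{M+1}$, then $G^+\stackrel{1/r}{\longrightarrow}K_n$, where $G^+$ is the graph obtained from $G$ by adding a new vertex and joining it to every vertex of $G$.
   Context: All graphs are finite and simple. For a graph $H$ and a positive integer $s$, write $G\stackrel{1/s}{\longrightarrow}H$ if every colouring of $E(G)$ with $s+1$ colours admits a copy of $H$ in $G$ (a not necessarily induced subgraph isomorphic to $H$) whose edges use at most $s$ of the colours. For integers $n_1,\ldots,n_{r+1}\ge 2$, the off-diagonal number $R_{1/r}(n_1,\ldots,n_{r+1})$ is the least $N$ such that for every colouring of $E(K_N)$ with colours $1,\ldots,r+1$ there is some $i\in\{1,\ldots,r+1\}$ and a copy of $K_{n_i}$ in $K_N$ none of whose edges has colour $i$. *)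

(* Defs.v *)
From Stdlib Require Import Classical_Prop.
From mathcomp Require Import all_boot.

Set Implicit Arguments.
Unset Strict Implicit.
Unset Printing Implicit Defensive.

Record sgraph := SGraph {
  vertex :> finType;
  adj : rel vertex;
  adj_sym : symmetric adj;
  adj_irr : irreflexive adj }.

Section Complete.
Variable n : nat.
Definition complete_adj : rel 'I_n := fun x y => x != y.
Lemma complete_sym : symmetric complete_adj.
Proof. by move=> x y; rewrite /complete_adj eq_sym. Qed.
Lemma complete_irr : irreflexive complete_adj.
Proof. by move=> x; rewrite /complete_adj eqxx. Qed.
Definition complete := SGraph complete_sym complete_irr.
End Complete.

(* The new vertex is None. *)
Section Cone.
Variable G : sgraph.
Definition cone_adj : rel (option G) := fun x y =>
  match x, y with
  | Some u, Some v => adj u v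
  | None, None => false
  | _, _ => true
  end.
Lemma cone_sym : symmetric cone_adj.
Proof. by move=> [u|] [v|] //=; rewrite adj_sym. Qed.
Lemma cone_irr : irreflexive cone_adj.
Proof. by move=> [u|] //=; rewrite adj_irr. Qed.
Definition cone := SGraph cone_sym cone_irr.
End Cone.

(* f exhibits a copy of H in G, not necessarily induced. *)
Definition is_copy (H G : sgraph) (f : H -> G) : Prop :=
  injective f /\ forall x y : H, adj x y -> adj (f x) (f y).

(* An edge colouring of G with k > 0 colours is a function on all sets of
   vertices that is only ever evaluated at edges [set u; v]; since k > 0, every
   function on E(G) extends to such a function. *)
Definition colouring (G : sgraph) (k : nat) := {set G} -> 'I_k.

Definition colours_used (H G : sgraph) (k : nat) (c : colouring G k)
    (f : H -> G) : {set 'I_k} :=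
  [set c [set f e.1; f e.2] | e : H * H & adj e.1 e.2].

(* G -(1/s)-> H *)
Definition arrows (s : nat) (G H : sgraph) : Prop :=
  forall c : colouring G s.+1,
    exists f : H -> G, is_copy f /\ #|colours_used c f| <= s.

Definition offdiag_prop (r : nat) (ns : r.+1.-tuple nat) (N : nat) : Prop :=
  forall c : colouring (complete N) r.+1,
    exists (i : 'I_r.+1) (f : complete (tnth ns i) -> complete N),
      is_copy f /\ i \notin colours_used c f.

(* M = R_{1/r}(ns) *)
Definition is_offdiag_ramsey (r : nat) (ns : r.+1.-tuple nat) (M : nat) : Prop :=
  offdiag_prop ns M /\ forall N : nat, offdiag_prop ns N -> M <= N.

(* R_{1/r}(ns) exists for r > 0: merging all colours but the first reduces this
   to the two-colour Ramsey theorem. *)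
Lemma ramsey2 (a b : nat) : exists N, forall (T : finType) (A : {set T})
    (e : rel T), symmetric e -> N <= #|A| ->
  exists S : {set T}, S \subset A /\
    ((#|S| = a /\ {in S &, forall x y, x != y -> e x y}) \/
     (#|S| = b /\ {in S &, forall x y, x != y -> ~~ e x y})).
Proof.
elim: a b => [|a IHa] b.
  exists 0 => T A e _ _; exists set0; rewrite sub0set; split=> //.
  by left; rewrite cards0; split=> // x; rewrite inE.
elim: b => [|b [N2 H2]].
  exists 0 => T A e _ _; exists set0; rewrite sub0set; split=> //.
  by right; rewrite cards0; split=> // x; rewrite inE.
have [N1 H1] := IHa b.+1; exists (N1 + N2).+1 => T A e esym leA.
have /card_gt0P[v vA] : 0 < #|A| by apply: leq_trans leA.
have cardA : N1 + N2 <= #|A :\ v| by move: leA; rewrite (cardsD1 v) vA.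
pose B := [set x in A :\ v | e v x]; pose C := [set x in A :\ v | ~~ e v x].
have cardBC : #|A :\ v| = #|B| + #|C|.
  rewrite -(cardsID [set x | e v x]); congr (_ + _); apply: eq_card => x;
  by rewrite !inE // andbC.
have BsA : B \subset A by apply/subsetP=> x; rewrite !inE => /andP[/andP[]].
have CsA : C \subset A by apply/subsetP=> x; rewrite !inE => /andP[/andP[]].
have [leB|ltB] := leqP N1 #|B|.
  have [S [SB [[cS eS]|[cS eS]]]] := H1 _ B e esym leB; last first.
    by exists S; split; [exact: subset_trans BsA | right].
  have vS : v \notin S by apply/negP => /(subsetP SB); rewrite !inE eqxx.
  exists (v |: S); rewrite subUset sub1set vA (subset_trans SB BsA); split=> //.
  left; rewrite cardsU1 vS cS; split=> // x y /setU1P[->|xS] /setU1P[->|yS].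
  - by rewrite eqxx.
  - by move: (subsetP SB _ yS); rewrite !inE => /andP[].
  - by move: (subsetP SB _ xS); rewrite !inE esym => /andP[].
  - exact: eS.
have leC : N2 <= #|C|.
  by rewrite -(leq_add2l N1) (leq_trans cardA) // cardBC leq_add2r ltnW.
have [S [SC [[cS eS]|[cS eS]]]] := H2 _ C e esym leC.
  by exists S; split; [exact: subset_trans CsA | left].
have vS : v \notin S by apply/negP => /(subsetP SC); rewrite !inE eqxx.
exists (v |: S); rewrite subUset sub1set vA (subset_trans SC CsA); split=> //.
right; rewrite cardsU1 vS cS; split=> // x y /setU1P[->|xS] /setU1P[->|yS].
- by rewrite eqxx.
- by move: (subsetP SC _ yS); rewrite !inE => /andP[].
- by move: (subsetP SC _ xS); rewrite !inE esym => /andP[].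
- exact: eS.
Qed.

Lemma offdiag_ramsey_exists (r : nat) (ns : r.+1.-tuple nat) :
  0 < r -> exists M, is_offdiag_ramsey ns M.
Proof.
case: r ns => // r ns _; suff [N PN] : exists N, offdiag_prop ns N.
  elim/ltn_ind: N PN => N IH PN.
  have [[K [ltKN PK]]|noK] :=
    classic (exists K, K < N /\ offdiag_prop ns K); first exact: IH PK.
  exists N; split=> // K PK; rewrite leqNgt; apply/negP=> ltKN.
  by apply: noK; exists K.
have [N HN] := ramsey2 (tnth ns ord_max) (tnth ns ord0); exists N => c.
have col_sym : symmetric (fun x y : 'I_N => c [set x; y] == ord0).
  by move=> x y; rewrite setUC.
have [|S [_ HS]] := HN _ [set: 'I_N] _ col_sym; first by rewrite cardsT card_ord.
suff copyS i : #|S| = tnth ns i ->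
    {in S &, forall x y, x != y -> c [set x; y] != i} ->
    exists f : complete (tnth ns i) -> complete N,
      is_copy f /\ i \notin colours_used c f.
  case: HS => -[cS eS]; [exists ord_max | exists ord0]; apply: copyS => //.
  by move=> x y xS yS /eS-/(_ xS yS)/eqP->.
move=> cS avoid; pose f (x : 'I_(tnth ns i)) := enum_val (cast_ord (esym cS) x).
have injf : injective f by move=> x y /enum_val_inj/cast_ord_inj.
exists f; split; first by split=> // x y; apply: contra_neq => /injf.
apply/imsetP=> -[[x y] /= xy ci].
suff /eqP : c [set f x; f y] != i by rewrite ci.
apply: avoid; first exact: enum_valP; first exact: enum_valP.
by apply/eqP=> /injf exy; move: xy; rewrite inE exy /= complete_irr.
Qed.

(* Main.v *)
Require Import Defs.
From mathcomp Require Import all_boot.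
From mathcomp Require Import perm.

(** Write [w v] for the colour of the edge from the apex of [G^+] to [v].
    Colour an edge [uv] of [G] by [w u] if [w u = w v], and by a new colour
    otherwise. A copy of [K_(M+1)] missing one of these [r+2] colours has, for
    some old colour [j], at least [M] vertices with [w <> j]: if [j] is missing
    then [w = j] at most once, and if the new colour is missing then [w] is
    constant. On these [M] vertices there is a [K_n] missing a colour, or a
    [K_(n-1)] missing [j], which the apex extends to a [K_n] missing [j]. *)

Lemma card_ltn_ord_notin {k s : nat} (A : {set 'I_k}) :
  #|A| <= s -> s < k -> exists i, i \notin A.
Proof.
move=> leA lts; apply/existsP; rewrite -negb_forall.
apply/negP => /forallP allA; move: lts; rewrite ltnNge -{1}(card_ord k).
by case/negP; apply: leq_trans leA; apply/subset_leq_card/subsetP => i.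
Qed.

Lemma notin_colours_used {m k : nat} {G : sgraph} {c : colouring G k}
    {f : complete m -> G} {i : 'I_k} :
  i \notin colours_used c f -> forall x y, x != y -> c [set f x; f y] != i.
Proof.
move=> iP x y xy; apply: contraNneq iP => <-.
by apply/imsetP; exists (x, y); rewrite ?inE.
Qed.

(** Stated for a vertex set [S] rather than a map, so that the apex can be added to a clique by
    [|:]. Missing one of [r.+1] colours leaves at most [r]. *)
Lemma clique_few_colours {m r : nat} {G : sgraph} (c : colouring G r.+1)
    (k : 'I_r.+1) (S : {set G}) :
  #|S| = m ->
  {in S &, forall x y, x != y -> adj x y /\ c [set x; y] != k} ->
  exists f : complete m -> G, is_copy f /\ #|colours_used c f| <= r.
Proof.
move=> cS SP; pose f (x : complete m) : G := enum_val (cast_ord (esym cS) x).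
have injf : injective f by move=> x y /enum_val_inj/cast_ord_inj.
have fP (x y : complete m) : x != y -> adj (f x) (f y) /\ c [set f x; f y] != k.
  by move=> xy; apply: SP; rewrite ?enum_valP ?(inj_eq injf).
exists f; split; first by split=> // x y /fP[].
have cT : #|[set: 'I_r.+1]| = r.+1 by rewrite cardsT card_ord.
rewrite -ltnS -[ltnRHS]cT; apply: proper_card.
rewrite properT; apply/eqP => colT.
have: k \in colours_used c f by rewrite colT inE.
case/imsetP => -[x y]; rewrite inE /= => /fP[_ /eqP ck] kE.
by rewrite kE in ck.
Qed.

(** A colouring acts on sets, so agreement of [w] at the two ends is read off the image of the edge.
    Old colours embed by [lift ord_max]; [ord_max] is the new one. *)
Definition mono_colour {T : finType} {k : nat} (w : T -> 'I_k)
    (A : {set T}) : 'I_k.+1 :=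
  if [pick i | w @: A == [set i]] is Some i then lift ord_max i else ord_max.

Lemma mono_colour_eq {T : finType} {k : nat} (w : T -> 'I_k) (u v : T) :
  w u = w v -> mono_colour w [set u; v] = lift ord_max (w u).
Proof.
move=> uv; rewrite /mono_colour imsetU1 imset_set1 -uv setUid.
by case: pickP => [i /eqP/set1_inj->|/(_ (w u))] //; rewrite eqxx.
Qed.

Lemma mono_colour_neq {T : finType} {k : nat} (w : T -> 'I_k) (u v : T) :
  w u != w v -> mono_colour w [set u; v] = ord_max.
Proof.
move=> uv; rewrite /mono_colour imsetU1 imset_set1.
case: pickP => // i /eqP E; case/eqP: uv.
have /set1P-> : w u \in [set i] by rewrite -E set21.
by have /set1P-> : w v \in [set i] by rewrite -E set22.
Qed.

Lemma copy_mostly_avoids {r M : nat} {G : sgraph} (w : G -> 'I_r.+2) :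
  arrows r.+2 G (complete M.+1) ->
  exists (f : complete M.+1 -> G) (j : 'I_r.+2),
    is_copy f /\ M <= #|[set x | w (f x) != j]|.
Proof.
move=> /(_ (mono_colour w))[f [fcopy /card_ltn_ord_notin/(_ (ltnSn _))[k]]].
move=> /notin_colours_used kP; exists f.
case: (unliftP ord_max k) => [j kE|kE]; rewrite {}kE in kP.
  (* Two vertices of the copy with [w = j] would span an edge of the missing colour
     [lift ord_max j]. *)
  exists j; split=> //; have := cardsC [set x | w (f x) == j]; rewrite card_ord.
  have -> : ~: [set x | w (f x) == j] = [set x | w (f x) != j].
    by apply/setP => x; rewrite !inE.
  move=> cM; rewrite -(leq_add2l 1) add1n -[leqLHS]cM.
  rewrite leq_add2r; apply/card_le1_eqP => x y; rewrite !inE => /eqP wx /eqP wy.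
  apply/eqP; apply: contraT => xy.
  by have := kP y x xy; rewrite mono_colour_eq wy ?wx ?eqxx.
have wconst x : w (f x) = w (f ord0).
  have [->//|x0] := eqVneq x ord0.
  apply/eqP; apply: contraT => wx.
  by have := kP x ord0 x0; rewrite mono_colour_neq ?eqxx.
(* With at least two old colours, some [j] differs from the constant value of [w]. *)
have [j jP] : exists j, w (f ord0) != j.
  have [->|] := eqVneq (w (f ord0)) ord0; first by exists ord_max.
  by exists ord0.
exists j; split=> //.
have -> : [set x | w (f x) != j] = setT.
  by apply/setP => x; rewrite !inE wconst.
by rewrite cardsT card_ord.
Qed.

Theorem theorem1p3 (n r : nat) (hn : 3 <= n) (hr : 2 <= r) (M : nat)
    (hM : is_offdiag_ramsey [tuple of n.-1 :: nseq r n] M) (G : sgraph) :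
  arrows r.+1 G (complete M.+1) -> arrows r (cone G) (complete n).
Proof.
case: r hr hM => // r _ [hM _] hG c.
pose w (v : G) := c [set None; Some v].
have [f [j [[injf adjf] leM]]] := copy_mostly_avoids w hG.
pose g (x : 'I_M) : 'I_M.+1 := enum_val (widen_ord leM x).
have injg : injective g by move=> x y /enum_val_inj/(congr1 val) /= /val_inj.
have wg x : w (f (g x)) != j.
  by have := enum_valP (widen_ord leM x); rewrite inE.
pose h (x : 'I_M) : cone G := Some (f (g x)).
have injh : injective h by move=> x y [] /injf/injg.
have adjh x y : x != y -> adj (h x) (h y).
  by move=> xy; apply: adjf; apply: contra_neq xy => /injg.
(* The argument [n.-1] sits at index [ord0]; swapping colours [ord0] and [j] assigns it to [j].
   Undoing the swap, [c] misses [k] on the clique found. *)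
have [i [f' [[injf' _] /notin_colours_used iP]]] :=
  hM (fun A => tperm ord0 j (c (h @: A))).
pose k := tperm ord0 j i.
have kP x y : x != y -> c [set h (f' x); h (f' y)] != k.
  move=> xy; apply: contra_neq (iP x y xy).
  by rewrite imsetU1 imset_set1 => ->; rewrite tpermK.
pose S : {set cone G} := [set h (f' x) | x in setT].
have cS : #|S| = tnth [tuple of n.-1 :: nseq r.+1 n] i.
  by rewrite card_imset ?cardsT ?card_ord // => x y /injh/injf'.
have SP : {in S &, forall x y, x != y -> adj x y /\ c [set x; y] != k}.
  move=> _ _ /imsetP[x _ ->] /imsetP[y _ ->] xy.
  have {}xy : x != y by apply: contra_neq xy => ->.
  by split; [apply: adjh; rewrite (inj_eq injf') | exact: kP].
have [i0|i0] := eqVneq i ord0; last first.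
  apply: clique_few_colours SP; rewrite cS.
  case: (unliftP ord0 i) i0 => [i' -> _|-> /eqP//].
  (* The default [n] equals the entries of [nseq], so both branches of the bound test agree. *)
  by rewrite (tnth_nth n) lift0 [LHS]nth_nseq if_same.
have kj : k = j by rewrite /k i0 tpermL.
have NS : None \notin S by apply/imsetP => -[].
(* All of [S] comes from vertices with [w != j], so the edges from the apex miss [j] too. *)
have NP z : z \in S -> adj (None : cone G) z /\ c [set None; z] != k.
  by case/imsetP => x _ ->; split=> //; rewrite kj; apply: wg.
apply: (clique_few_colours c k (None |: S)).
  by rewrite cardsU1 NS cS i0 tnth0 add1n prednK // (leq_trans _ hn).
move=> x y /setU1P[->|xS] /setU1P[->|yS] xy.
- by rewrite eqxx in xy.
- exact: NP.
- by rewrite adj_sym setUC; apply: NP.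
- exact: SP.
Qed.
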